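(* Let $p\ge2$ and, for each environment $j$ in a finite set $\mathcal J$ with $|\mathcal J|\ge2$, let the $\mathbb R^p$-valued random vector $\mathbf x_j$ satisfy $\mathbf x_j=\mathbf B\mathbf x_j+\mathbf c_j+\mathbf e_j$ under assumptions (A), (B), (C) given in the context. Consider the identifiability condition (U) for all $k,l\in\{1,\dots,p\}$ with $k\neq l$ there exist $j,j'\in\mathcal J$ such that $\eta_{j,k}\,\eta_{j',l}\ne\eta_{j,l}\,\eta_{j',k}$. (i) If $|\mathcal J|=2$, then $\eta_{j,k}=-\eta_{j',k}$ for all $k$ and $j\ne j'$, and condition (U) cannot be satisfied. Hence at least three different environments are needed for identifiability, i.e. for the minimizer of $\mathbf D'\mapsto\sum_{j\in\mathcal J}L(\mathbf D'\,\mathbf{\Delta\Sigma}_{\mathbf x,j}\,\mathbf D'^T)$ over $\mathcal D_{cp}$ to be unique. (ii) If $|\mathcal J|\ge3$ and the intervention variances $(\mathbf\Sigma_{\mathbf c,j})_{kk}$, $k\in\{1,\dots,p\}$, $j\in\mathcal J$, are chosen independently (over all variables $k$ and all environments $j$) from a distribution that is absolutely continuous with respect to Lebesgue measure, then condition (U) is satisfied almost surely.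
   Context: Cycle-product: a cycle of length $\eta$ is a tuple $(m_1,\dots,m_{\eta+1}=m_1)\in\{1,\dots,p\}^{1+\eta}$ with $m_k\ne m_\ell$ for $1\le k<\ell\le\eta$. For $\mathbf M\in\mathbb R^{p\times p}$, $$\mathrm{CP}(\mathbf M):=\max_{(m_1,\dots,m_{\eta+1})\text{ cycle},\ 1<\eta\le p}\ \prod_{1\le k\le\eta}|\mathbf M_{m_{k+1},m_k}|.$$ Model assumptions: $\mathbf B\in\mathbb R^{p\times p}$ is deterministic; $\mathbf c_j,\mathbf e_j$ are random vectors in $\mathbb R^p$ with finite second moments; $\mathbf e_j$ has mean $0$ and positive semi-definite covariance (not necessarily diagonal). (A) $\mathbf I-\mathbf B$ is invertible, $\mathrm{CP}(\mathbf B)<1$, and the diagonal entries of $\mathbf B$ are zero. (B) $\mathbf B$ and the distribution of $\mathbf e_j$ are the same for all $j\in\mathcal J$, and for each $j$ the vectors $\mathbf c_j$ and $\mathbf e_j$ are uncorrelated. (C) For each $j\in\mathcal J$, $\mathbf\Sigma_{\mathbf c,j}=\mathrm{Cov}(\mathbf c_j)$ is diagonal. Covariances: for $\mathbf a\in\{\mathbf x,\mathbf c\}$ let $\mathbf\Sigma_{\mathbf a,j}:=\mathrm{Cov}(\mathbf a_j)$, $\mathbf\Sigma_{\mathbf a,-j}:=\frac1{|\mathcal J|-1}\sum_{j'\in\mathcal J\setminus\{j\}}\mathbf\Sigma_{\mathbf a,j'}$, and $\mathbf{\Delta\Sigma}_{\mathbf a,j}:=\mathbf\Sigma_{\mathbf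 a,j}-\mathbf\Sigma_{\mathbf a,-j}$. Let $\eta_{j,k}:=(\mathbf{\Delta\Sigma}_{\mathbf c,j})_{kk}$. Constraint set: $\mathcal D_{cp}:=\{\mathbf D\in\mathbb R^{p\times p}:\ \mathbf D\text{ invertible},\ \mathbf D_{kk}=1\text{ for all }k,\ \mathrm{CP}(\mathbf I-\mathbf D)<1\}$. Loss: $L(\mathbf A):=\sum_{k\ne l}\mathbf A_{k,l}^2$. *)

(* Defs.v *)
From HB Require Import structures.
From mathcomp Require Export all_boot all_order all_algebra.
From mathcomp Require Export all_classical all_reals all_analysis.
Set Implicit Arguments.
Unset Strict Implicit.
Unset Printing Implicit Defensive.
Export Order.TTheory GRing.Theory Num.Theory.
Export numFieldNormedType.Exports.
Local Open Scope classical_set_scope.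
Local Open Scope ring_scope.

Section CycleProduct.
Context {R : realType} {p : nat}.

(* [m] is the closed tuple (m_1, ..., m_eta, m_(eta+1)), stored with indices
   0, ..., eta; its first eta entries are pairwise distinct. *)
Definition is_cycle (eta : nat) (m : eta.+1.-tuple 'I_p) : bool :=
  (tnth m ord_max == tnth m ord0) &&
  [forall k : 'I_eta, forall l : 'I_eta,
     (k < l)%N ==> (tnth m (widen_ord (leqnSn eta) k)
                      != tnth m (widen_ord (leqnSn eta) l))].

(* All the products are nonnegative, and there is a cycle of length 2 as soon
   as p >= 2; the value 0 of the empty maximum is then immaterial. *)
Definition CP (M : 'M[R]_p) : R :=
  \big[Num.max/0]_(eta < p.+1 | (1 < eta)%N)
    \big[Num.max/0]_(m : eta.+1.-tuple 'I_p | is_cycle m)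
      \prod_(k < eta)
        `| M (tnth m (lift ord0 k)) (tnth m (widen_ord (leqnSn eta) k)) |.

Definition Dcp : set 'M[R]_p :=
  [set D | [/\ D \in unitmx, forall k, D k k = 1 & CP (1%:M - D) < 1]].

Definition loss (A : 'M[R]_p) : R := \sum_k \sum_(l | l != k) A k l ^+ 2.

End CycleProduct.

Definition is_minimizer {T : Type} {R : realType} (f : T -> R) (S : set T)
    (x : T) : Prop :=
  S x /\ forall y, S y -> f x <= f y.

Section RandomVectors.
Context {d : measure_display} {T : measurableType d} {R : realType}.
Context (P : probability T R) {p : nat}.

(* Random vectors take their values in [p.-tuple R], which carries the product
   sigma-algebra. *)
Definition component (a : T -> p.-tuple R) (k : 'I_p) : T -> R :=
  fun t => tnth (a t) k.

Definition column (u : p.-tuple R) : 'cV[R]_p := \col_k tnth u k.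

Definition finite_second_moments (a : T -> p.-tuple R) : Prop :=
  forall k, component a k \in Lfun P 2%:E.

Definition cov_mx (a : T -> p.-tuple R) : 'M[R]_p :=
  \matrix_(k, l) fine (covariance P (component a k) (component a l)).

Definition uncorrelated (a b : T -> p.-tuple R) : Prop :=
  forall k l, covariance P (component a k) (component b l) = 0%E.

End RandomVectors.

(* Equality of laws is required on measurable sets only: the value of a
   probability elsewhere carries no information. *)
Definition same_law {d : measure_display} {T : measurableType d} {R : realType}
    (mu nu : set T -> \bar R) : Prop :=
  forall A, measurable A -> mu A = nu A.

Definition mutually_independent {d d' : measure_display} {T : measurableType d}
    {T' : measurableType d'} {R : realType} {I : finType}
    (P : probability T R) (X : I -> T -> T') : Prop :=
  forall (S : {set I}) (A : I -> set T'),
    (forall i, i \in S -> measurable (A i)) ->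
    P (\bigcap_(i in [set` S]) (X i @^-1` A i))
    = (\prod_(i in S) P (X i @^-1` A i))%E.

Definition psd {R : realType} {p : nat} (S : 'M[R]_p) : Prop :=
  S^T = S /\ forall v : 'cV[R]_p, 0 <= (v^T *m S *m v) 0 0.

(* One observed vector x_j, one intervention c_j and one noise vector e_j per
   environment j, on a common probability space. *)
Record environments (R : realType) (p : nat) (J : finType) := Environments {
  env_display : measure_display;
  env_space : measurableType env_display;
  env_prob : probability env_space R;
  xvec : J -> {RV env_prob >-> p.-tuple R};
  cvec : J -> {RV env_prob >-> p.-tuple R};
  evec : J -> {RV env_prob >-> p.-tuple R} }.

Section Model.
Context {R : realType} {p : nat} {J : finType}.
Implicit Types (B : 'M[R]_p) (M : environments R p J).

Definition Sigma_x M (j : J) : 'M[R]_p := cov_mx (env_prob M) (xvec M j).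
Definition Sigma_c M (j : J) : 'M[R]_p := cov_mx (env_prob M) (cvec M j).
Definition Sigma_e M (j : J) : 'M[R]_p := cov_mx (env_prob M) (evec M j).

Definition Sigma_minus (S : J -> 'M[R]_p) (j : J) : 'M[R]_p :=
  (#|J|.-1)%:R^-1 *: \sum_(j' | j' != j) S j'.

Definition DeltaSigma (S : J -> 'M[R]_p) (j : J) : 'M[R]_p :=
  S j - Sigma_minus S j.

Definition eta M (j : J) (k : 'I_p) : R := DeltaSigma (Sigma_c M) j k k.

Definition structural_equation B M : Prop :=
  forall j, {ae env_prob M, forall t,
    column (xvec M j t) =
      B *m column (xvec M j t) + column (cvec M j t) + column (evec M j t)}.

Definition moment_conditions M : Prop :=
  forall j, [/\ finite_second_moments (env_prob M) (cvec M j),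
                finite_second_moments (env_prob M) (evec M j),
                forall k, ('E_(env_prob M)[component (evec M j) k] = 0)%E
              & psd (Sigma_e M j)].

Definition assumption_A B : Prop :=
  [/\ 1%:M - B \in unitmx, CP B < 1 & forall k, B k k = 0].

(* The invariance of B across environments is built into
   [structural_equation], where B does not depend on j. *)
Definition assumption_B M : Prop :=
  (forall j j', same_law (distribution (env_prob M) (evec M j))
                         (distribution (env_prob M) (evec M j'))) /\
  (forall j, uncorrelated (env_prob M) (cvec M j) (evec M j)).

Definition assumption_C M : Prop := forall j, is_diag_mx (Sigma_c M j).

Definition shift_model B M : Prop :=
  [/\ structural_equation B M, moment_conditions M,
      assumption_A B, assumption_B M & assumption_C M].

Definition condition_U M : Prop :=
  forall k l : 'I_p, k != l ->
    exists j j' : J, eta M j k * eta M j' l != eta M j l * eta M j' k.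

Definition objective M (D : 'M[R]_p) : R :=
  \sum_(j : J) loss (D *m DeltaSigma (Sigma_x M) j *m D^T).

Definition identifiable M : Prop :=
  exists! D : 'M[R]_p, is_minimizer (objective M) Dcp D.

End Model.

(* Main.v *)
From HB Require Import structures.
From mathcomp Require Import measurable_realfun ring lra.
Require Import Defs.
Set Implicit Arguments.
Unset Strict Implicit.
Unset Printing Implicit Defensive.
Local Open Scope classical_set_scope.
Local Open Scope ring_scope.

(* (i) With two environments the matrices DeltaSigma_c are h and -h for one
   diagonal matrix h, and DeltaSigma_x = (1 - B)^-1 DeltaSigma_c (1 - B)^-T
   since the noise terms cancel. So 1 - B annihilates the objective, and so does
   W (1 - B) for any W with W h W^T diagonal; as CP < 1 and invertibility are
   open conditions, such a W different from 1 can be chosen close to 1.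

   (ii) eta_j - eta_j' is a fixed nonzero multiple of the difference of the
   intervention variances. Hence the failure of (U) at k, l forces, for three
   environments with variances a_i at k and b_i at l,
   (a1 - a3) (b2 - b3) = (a2 - a3) (b1 - b3). Outside the null event a1 = a3
   this prescribes b2 as a function of the other five variables, which has
   probability 0 because b2 is independent of them and atomless. *)

(** * Independence and atomless laws *)

(** These sets form a pi-system generating the sigma-algebra of the variables [X i] with [i] in
    [S]. *)
Definition cylinders {T : Type} {d'} {T' : measurableType d'} {I : finType}
    (X : I -> T -> T') (S : {set I}) : set (set T) :=
  [set C | exists2 A : I -> set T', (forall i, measurable (A i)) &
     C = \bigcap_(i in [set` S]) (X i @^-1` A i)].

Section Independence.
Context {d d' : measure_display} {T : measurableType d} {T' : measurableType d'}
  {R : realType} {I : finType}.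
Context (P : probability T R) (X : I -> {mfun T >-> T'}).

Lemma cylindersI (S : {set I}) : setI_closed (cylinders (fun i => X i : T -> T') S).
Proof.
move=> _ _ [A mA ->] [A' mA' ->].
exists (fun i => A i `&` A' i); first by move=> i; exact: measurableI.
by rewrite -bigcapI; apply: eq_bigcapr => i _; rewrite preimage_setI.
Qed.

Lemma measurable_cylinders (S : {set I}) :
  cylinders (fun i => X i : T -> T') S `<=` measurable.
Proof.
move=> _ [A mA ->]; apply: fin_bigcap_measurable => // i _.
rewrite -[_ @^-1` _]setTI; exact: measurable_funP.
Qed.

Lemma cylinders_measurable_fun (S : {set I}) (i : I) : i \in S ->
  measurable_fun [set: g_sigma_algebraType (cylinders (fun i => X i : T -> T') S)]
    (X i : T -> T').
Proof.
move=> iS _ A mA; rewrite setTI; apply: sub_sigma_algebra.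
exists (fun j => if j == i then A else setT).
  by move=> j; case: ifP.
apply/seteqP; split=> [t At j _ /=|t /(_ i iS) /=]; last by rewrite eqxx.
by case: eqP => // ->.
Qed.

(** Both sides are finite measures in [C] that agree on the pi-system of cylinders, by mutual
    independence, hence on the sigma-algebra it generates. *)
Lemma independent_cylinders (S : {set I}) (i : I) (A : set T') (C : set T) :
  mutually_independent P (fun i => X i : T -> T') ->
  i \notin S -> measurable A -> <<s cylinders (fun i => X i : T -> T') S >> C ->
  P (C `&` X i @^-1` A) = (P C * P (X i @^-1` A))%E.
Proof.
move=> Pind iS mA.
have mXA : measurable (X i @^-1` A).
  by rewrite -[_ @^-1` _]setTI; exact: measurable_funP.
pose r : R := fine (P (X i @^-1` A)).
have rE : (P (X i @^-1` A) = r%:E)%E by rewrite /r fineK// fin_num_measure.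
have r0 : 0 <= r by rewrite /r fine_ge0.
pose m1 := mrestr P mXA.
pose m2 := mscale (NngNum r0) P.
move=> sC.
have -> : P (C `&` X i @^-1` A) = m1 C by [].
have -> : (P C * P (X i @^-1` A) = m2 C)%E by rewrite rE muleC.
apply: (g_sigma_algebra_measure_unique (cylinders (fun i => X i : T -> T') S)
  _ (fun=> setT)) => //.
- exact: measurable_cylinders.
- move=> _; exists (fun=> setT) => //.
  by apply/seteqP; split.
- by apply/seteqP; split=> // t _; exists 0%N.
- exact: cylindersI.
- move=> _ [B mB ->].
  suff : (P (\bigcap_(j in [set` S]) X j @^-1` B j `&` X i @^-1` A) =
      P (X i @^-1` A) * P (\bigcap_(j in [set` S]) X j @^-1` B j))%E.
    by rewrite rE.
  (* Inserting [A] at [i] gives an intersection indexed by [i |: S]; mutual independence is then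
     applied to [i |: S] and to [S]. *)
  pose B' j := if j == i then A else B j.
  have mB' j : measurable (B' j) by rewrite /B'; case: ifP.
  have eB' : {in S, forall j, B' j = B j}.
    move=> j jS; rewrite /B'; case: eqP => // ji; move: iS.
    by rewrite -ji jS.
  have -> : \bigcap_(i0 in [set` S]) X i0 @^-1` B i0 `&` X i @^-1` A =
      \bigcap_(j in [set` (i |: S)]) X j @^-1` B' j.
    apply/seteqP; split=> t.
      move=> [h1 h2] j /=; rewrite !inE /B'; case: eqP => [->//|_ /= jS].
      exact: h1.
    move=> h; split=> [j jS|].
      by rewrite -eB'//; apply: h => /=; rewrite !inE jS orbT.
    by have := h i; rewrite /= setU11 /B' eqxx; apply.
  rewrite Pind//.
  rewrite big_setU1//= /B' eqxx; congr (_ * _)%E.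
  rewrite -(@Pind S B')//.
  by congr (P _); apply: eq_bigcapr => j jS; rewrite eB'.
- by move=> _; rewrite /= /mrestr setTI (le_lt_trans (probability_le1 _ mXA))// ltry.
Qed.

End Independence.

Section Linear.
Context {d : measure_display} {T : measurableType d}
  {R : realType} {I : finType}.
Context (P : probability T R) (X : I -> {RV P >-> R}).

(** Measurability for the generated sigma-algebra makes [(u, w)] independent of [X i]. The joint law
    is thus a product, and by Fubini it suffices that the sections of the exceptional set [N] be
    null. *)
Lemma independent_linear_ae (S : {set I}) (i : I) (u w : T -> R) :
  mutually_independent P (fun i => X i : T -> R) ->
  i \notin S ->
  (forall y, P (X i @^-1` [set y]) = 0%E) ->
  measurable_fun [set: g_sigma_algebraType (cylinders (fun i => X i : T -> R) S)] u ->
  measurable_fun [set: g_sigma_algebraType (cylinders (fun i => X i : T -> R) S)] w ->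
  {ae P, forall t, u t != 0 -> u t * X i t != w t}.
Proof.
move=> Pind iS X0 mu mw.
have sub : <<s cylinders (fun i => X i : T -> R) S >> `<=` measurable.
  by apply: smallest_sub; [exact: sigma_algebra_measurable|
    exact: measurable_cylinders].
pose uw (t : T) := (u t, w t).
have muw' : measurable_fun
    [set: g_sigma_algebraType (cylinders (fun i => X i : T -> R) S)] uw.
  exact: measurable_fun_pair.
have muw : measurable_fun [set: T] uw.
  by move=> _ A mA; apply: sub; exact: muw'.
pose UW : {mfun T >-> (R * R)%type} := HB.pack uw (isMeasurableFun.Build _ _ _ _ _ muw).
pose N : set ((R * R) * R) := [set z | (z.1.1 != 0) && (z.1.1 * z.2 == z.1.2)].
have mN : measurable N.
  rewrite -[N]setTI.
  have : measurable_fun setT (fun z : (R * R) * R => (z.1.1 != 0) && (z.1.1 * z.2 == z.1.2)).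
    apply: measurable_and.
      apply: measurable_neg; apply: measurable_fun_eqr => //.
      exact: measurableT_comp.
    apply: measurable_fun_eqr.
      by apply: measurable_funM => //; exact: measurableT_comp.
    exact: measurableT_comp.
  by move=> /(_ measurableT [set true]) /=; apply.
have mXi : measurable_fun setT (X i : T -> R) by exact: measurable_funP.
have muX : measurable_fun [set: T] (fun t => (uw t, X i t)).
  exact: measurable_fun_pair.
pose UX : {mfun T >-> ((R * R) * R)%type} :=
  HB.pack (fun t => (uw t, X i t)) (isMeasurableFun.Build _ _ _ _ _ muX).
have E := @product_measure_unique _ _ _ _ R (distribution P UW)
  (distribution P (X i)) (distribution P UX).
have {}E : (distribution P UW \x distribution P (X i))%E N = distribution P UX N.
  apply: E => // A B mA mB.
  rewrite /distribution /pushforward /=.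
  rewrite -(independent_cylinders Pind iS mB)//.
  by rewrite -[_ @^-1` _]setTI; exact: muw'.
exists (UX @^-1` N); split.
- by rewrite -[_ @^-1` _]setTI; exact: (measurable_funP UX).
- rewrite -[LHS]/(distribution P UX N) -E.
  rewrite /product_measure1; apply: integral0_eq => -[a b] _ /=.
  rewrite /distribution /pushforward.
  (* The section over [(a, b)] is empty if [a = 0] and lies in the point [b / a] otherwise. *)
  have [a0|a0] := eqVneq a 0.
    rewrite (_ : _ @^-1` _ = set0) ?measure0//.
    by apply/seteqP; split=> t //=; rewrite /xsection /= inE /N /= a0 eqxx.
  apply/eqP; rewrite -measure_le0 -(X0 (b / a)); apply: le_measure.
  - rewrite inE -[_ @^-1` _]setTI; apply: measurable_funP => //.
    exact: measurable_xsection.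
  - by rewrite inE -[_ @^-1` _]setTI; exact: measurable_funP.
  - move=> t; rewrite /xsection /= inE /N /= => /andP[_ /eqP <-].
    by rewrite mulrAC divff ?mul1r.
- move=> t /not_implyP[u0 /negP/negPn uXw]; exact/andP.
Qed.

End Linear.

(** * Condition (U) for independent intervention variances *)

Lemma eta_sub (R : realType) (p : nat) (J : finType) (M : environments R p J)
    (j j' : J) (k : 'I_p) :
  eta M j k - eta M j' k =
  (1 + (#|J|.-1)%:R^-1) * (Sigma_c M j k k - Sigma_c M j' k k).
Proof.
(* Completing the sum over the other environments to the sum over all of them isolates a term that
   does not depend on [i] and cancels in the difference. *)
have etaE i : eta M i k = (1 + (#|J|.-1)%:R^-1) * Sigma_c M i k k
    - (#|J|.-1)%:R^-1 * \sum_j' Sigma_c M j' k k.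
  rewrite /eta /DeltaSigma /Sigma_minus; move: (Sigma_c M) => s.
  rewrite !mxE summxE [in RHS](bigD1 i)//=.
  by ring.
by rewrite !etaE; ring.
Qed.

Lemma independent_condition_U (R : realType) (p : nat) (J : finType)
    (d : measure_display) (Omega : measurableType d)
    (P : probability Omega R) (M : Omega -> environments R p J)
    (V : J -> 'I_p -> {RV P >-> R})
    (mu : probability (measurableTypeR R) R) :
  (3 <= #|J|)%N ->
  (forall w j k, V j k w = Sigma_c (M w) j k k) ->
  mutually_independent P (fun i : J * 'I_p => V i.1 i.2 : Omega -> R) ->
  (forall j k, same_law (distribution P (V j k)) mu) ->
  mu `<< (@lebesgue_measure R) ->
  {ae P, forall w, condition_U (M w)}.
Proof.
move=> /card_gt2P[j1 [j2 [j3 [_ [j12 j23 j31]]]]] VE Vind Vlaw mu_ac.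
pose X (i : J * 'I_p) := V i.1 i.2.
(* Singletons are Lebesgue null, so absolute continuity makes every variance atomless. *)
have X0 i y : P (X i @^-1` [set y]) = 0%E.
  rewrite -[LHS]/(distribution P (V i.1 i.2) [set y]) Vlaw//.
  by apply/measure0_null_setP/mu_ac/measure0_null_setP => //;
    exact: lebesgue_measure_set1.
suff H (k l : 'I_p) : k != l ->
    {ae P, forall w, exists j j', eta (M w) j k * eta (M w) j' l
      != eta (M w) j l * eta (M w) j' k}.
  apply: filter_forall => k; apply: filter_forall => l.
  have [->|/[dup] kl /H] := eqVneq k l; first exact: nearW.
  by apply: filterS => w.
move=> kl.
(* All the variables in play except [b2], the one to be solved for. *)
pose S : {set J * 'I_p} := [set (j1, k); (j2, k); (j3, k); (j1, l); (j3, l)]%SET.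
pose gT := g_sigma_algebraType (cylinders (fun i => X i : Omega -> R) S).
pose a1 := X (j1, k) : Omega -> R; pose a2 := X (j2, k) : Omega -> R.
pose a3 := X (j3, k) : Omega -> R.
pose b1 := X (j1, l) : Omega -> R; pose b2 := X (j2, l) : Omega -> R.
pose b3 := X (j3, l) : Omega -> R.
have meas (A : {set J * 'I_p}) i : i \in A ->
    measurable_fun [set: g_sigma_algebraType
      (cylinders (fun i => X i : Omega -> R) A)] (X i : Omega -> R).
  exact: cylinders_measurable_fun.
have h13 : {ae P, forall w, 1 != 0 :> R -> 1 * a1 w != a3 w}.
  apply: (independent_linear_ae (S := [set (j3, k)]%SET) (u := cst 1) Vind).
  - by rewrite inE xpair_eqE eqxx andbT eq_sym.
  - exact: X0.
  - exact: measurable_cst.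
  - by apply: meas; rewrite inE.
have h2 : {ae P, forall w, a1 w - a3 w != 0 -> (a1 w - a3 w) * b2 w !=
   (a2 w - a3 w) * (b1 w - b3 w) + (a1 w - a3 w) * b3 w}.
  have [m1 m2 m3 n1 n3] : [/\ measurable_fun setT (a1 : gT -> R),
      measurable_fun setT (a2 : gT -> R), measurable_fun setT (a3 : gT -> R),
      measurable_fun setT (b1 : gT -> R) & measurable_fun setT (b3 : gT -> R)].
    by split; apply: meas; rewrite !inE eqxx ?orbT.
  apply: (independent_linear_ae (S := S) (i := (j2, l)) Vind).
  - by rewrite !inE !xpair_eqE eqxx [l == k]eq_sym (negbTE kl)
      (negbTE j23) [j2 == j1]eq_sym (negbTE j12) !andbF.
  - exact: X0.
  - exact: measurable_funB.
  - by apply: measurable_funD; apply: measurable_funM => //; exact: measurable_funB.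
apply: filterS2 h13 h2 => w /(_ (oner_neq0 _)) n13 n2.
apply: contrapT => nU; move: n2.
rewrite subr_eq0 -[a1 w]mul1r n13 mul1r => /(_ isT)/eqP; apply.
have etaC j j' : eta (M w) j k * eta (M w) j' l = eta (M w) j l * eta (M w) j' k.
  by apply/eqP; apply: contrapT => /negP ?; apply: nU; exists j, j'.
(* This equation, linear in [b2], is the one excluded almost surely by [h2]. *)
have E : (a1 w - a3 w) * (b2 w - b3 w) = (a2 w - a3 w) * (b1 w - b3 w); last first.
  by rewrite -E; ring.
have c0 : 1 + (#|J|.-1)%:R^-1 != 0 :> R.
  by rewrite gt_eqF// ltr_wpDr// invr_ge0.
rewrite /a1 /a2 /a3 /b1 /b2 /b3 /X /= !VE.
(* Each factor [c0] converts one difference of variances into a difference of [eta]; what remains is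
   a linear combination of three instances of [etaC]. *)
apply: (mulfI c0); rewrite !mulrA -!eta_sub.
apply: (mulfI c0); rewrite mulrCA -eta_sub [RHS]mulrCA -eta_sub.
by have := etaC j1 j2; have := etaC j1 j3; have := etaC j3 j2; lra.
Qed.

(** * Covariances in the structural equation *)

Section Covariance.
Context {d : measure_display} {T : measurableType d} {R : realType}.
Context (P : probability T R).
Implicit Types X Y : T -> R.

Let PT : P setT \is a fin_num.
Proof. exact: fin_num_measure. Qed.

Lemma Lfun2_sum (I : Type) (r : seq I) (a : I -> R) (X : I -> T -> R) :
  (forall i, X i \in Lfun P 2%:E) ->
  (fun t => \sum_(i <- r) a i * X i t) \in Lfun P 2%:E.
Proof.
move=> X2.
have p1 : (1 <= 2%:E :> \bar R)%E by rewrite lee_fin ler1n.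
elim: r => [|i r IH].
  under eq_fun do rewrite big_nil; exact: Lfun_cst.
under eq_fun do rewrite big_cons mulrC.
by apply: (Lfun_addr_closed P p1).2 => //; apply: Lfun_scale => //; rewrite ler1n.
Qed.

Lemma Lfun2_covariance_fin_num X Y : X \in Lfun P 2%:E -> Y \in Lfun P 2%:E ->
  covariance P X Y \is a fin_num.
Proof.
move=> X2 Y2; apply: covariance_fin_num; try exact: Lfun_subset12.
exact: Lfun2_mul_Lfun1.
Qed.

Lemma covariance_suml (I : Type) (r : seq I) (a : I -> R) (X : I -> T -> R) Y :
  (forall i, X i \in Lfun P 2%:E) -> Y \in Lfun P 2%:E ->
  fine (covariance P (fun t => \sum_(i <- r) a i * X i t) Y) =
  \sum_(i <- r) a i * fine (covariance P (X i) Y).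
Proof.
move=> X2 Y2; elim: r => [|i r IH].
  rewrite big_nil; under [X in covariance _ X _]eq_fun do rewrite big_nil.
  by rewrite covariance_cst_l.
rewrite big_cons -IH.
under [X in covariance _ X _]eq_fun do rewrite big_cons mulrC.
have aX2 : (a i \o* X i) \in Lfun P 2%:E by apply: Lfun_scale => //; rewrite ler1n.
have S2 := Lfun2_sum r a X2.
rewrite [LHS](_ : _ = fine (covariance P ((a i \o* X i) \+
  (fun t => \sum_(i <- r) a i * X i t)) Y)); last by [].
rewrite covarianceDl// fineD ?Lfun2_covariance_fin_num// covarianceZl;
  try exact: Lfun_subset12; last exact: Lfun2_mul_Lfun1.
by rewrite fineM ?Lfun2_covariance_fin_num.
Qed.

Lemma ae_eq_expectation X Y : measurable_fun setT X -> measurable_fun setT Y ->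
  {ae P, forall t, X t = Y t} -> ('E_P[X] = 'E_P[Y])%E.
Proof.
move=> mX mY XY; rewrite unlock; apply: ae_eq_integral => //;
  try exact: measurableT_comp.
by apply: filterS XY => t XY _; rewrite /= XY.
Qed.

(** The structural equation holds only almost everywhere, so covariances must be insensitive to null
    sets. *)
Lemma ae_eq_covariance X X' Y Y' :
  measurable_fun setT X -> measurable_fun setT X' ->
  measurable_fun setT Y -> measurable_fun setT Y' ->
  {ae P, forall t, X t = X' t} -> {ae P, forall t, Y t = Y' t} ->
  covariance P X Y = covariance P X' Y'.
Proof.
move=> mX mX' mY mY' XX YY; rewrite unlock.
rewrite (ae_eq_expectation mX mX' XX) (ae_eq_expectation mY mY' YY).
apply: ae_eq_expectation.
- by apply: measurable_funM; apply: measurable_funB.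
- by apply: measurable_funM; apply: measurable_funB.
- by apply: filterS2 XX YY => t {}XX {}YY; rewrite -[LHS]/((X t - _) * (Y t - _)) XX YY.
Qed.

Lemma measurable_component p (a : {RV P >-> p.-tuple R}) k :
  measurable_fun setT (component a k).
Proof. exact: (measurableT_comp (measurable_tnth k)). Qed.

(** With zero means, each covariance is the integral of [tnth z k * tnth z l] against the law of the
    vector. *)
Lemma same_law_cov_mx p (a b : {RV P >-> p.-tuple R}) :
  finite_second_moments P a -> finite_second_moments P b ->
  (forall k, 'E_P[component a k] = 0)%E ->
  (forall k, 'E_P[component b k] = 0)%E ->
  same_law (distribution P a) (distribution P b) ->
  cov_mx P a = cov_mx P b.
Proof.
have covE (x : {RV P >-> p.-tuple R}) k l : finite_second_moments P x ->
    (forall k, 'E_P[component x k] = 0)%E ->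
    covariance P (component x k) (component x l) =
    (\int[distribution P x]_z (tnth z k * tnth z l)%:E)%E.
  move=> x2 x0; rewrite covarianceE; last first.
  - exact: Lfun2_mul_Lfun1.
  - exact: Lfun_subset12.
  - exact: Lfun_subset12.
  rewrite !x0 mule0 sube0 unlock /distribution integral_pushforward//.
    by apply/measurable_EFinP; apply: measurable_funM; exact: measurable_tnth.
  exact: (Lfun1_integrable P (component x k \* component x l)).1
    (Lfun2_mul_Lfun1 (x2 k) (x2 l)).
move=> a2 b2 a0 b0 ab; apply/matrixP => k l; rewrite !mxE !covE//.
by congr fine; apply: eq_measure_integral => A mA _; exact: ab.
Qed.

(** Bilinearity of the covariance; the cross terms between [c] and [e] vanish. *)
Lemma cov_mx_mulmx p (x c e : {RV P >-> p.-tuple R}) (A : 'M[R]_p) :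
  finite_second_moments P c -> finite_second_moments P e ->
  uncorrelated P c e ->
  {ae P, forall t, column (x t) = A *m (column (c t) + column (e t))} ->
  cov_mx P x = A *m (cov_mx P c + cov_mx P e) *m A^T.
Proof.
move=> c2 e2 ce xE.
pose Z i : T -> R := component c i \+ component e i.
have p1 : (1 <= 2%:E :> \bar R)%E by rewrite lee_fin ler1n.
have Z2 i : Z i \in Lfun P 2%:E by exact: (Lfun_addr_closed P p1).2.
pose y k (t : T) := \sum_i A k i * Z i t.
have y2 k : y k \in Lfun P 2%:E by exact: Lfun2_sum.
have my k : measurable_fun setT (y k).
  by have /andP[] := y2 k; rewrite inE.
have xy k : {ae P, forall t, component x k t = y k t}.
  apply: filterS xE => t /matrixP/(_ k 0); rewrite !mxE /component => ->.
  by apply: eq_bigr => i _; rewrite !mxE.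
have covZ i j : fine (covariance P (Z i) (Z j)) = (cov_mx P c + cov_mx P e) i j.
  rewrite !mxE covarianceDl// !covarianceDr// ce (covarianceC P (component e i)) ce.
  by rewrite adde0 add0e fineD ?Lfun2_covariance_fin_num.
apply/matrixP => k l; rewrite [LHS]mxE.
rewrite (ae_eq_covariance (measurable_component x k) (my k)
  (measurable_component x l) (my l) (xy k) (xy l)).
rewrite covariance_suml// -mulmxA mxE; apply: eq_bigr => i _; congr (_ * _).
rewrite covarianceC covariance_suml// mxE; apply: eq_bigr => j _.
by rewrite covarianceC covZ mulrC [A^T _ _]mxE.
Qed.

End Covariance.

Lemma Sigma_xE (R : realType) (p : nat) (J : finType) (B : 'M[R]_p)
    (M : environments R p J) (j : J) : shift_model B M ->
  Sigma_x M j =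
  invmx (1%:M - B) *m (Sigma_c M j + Sigma_e M j) *m (invmx (1%:M - B))^T.
Proof.
move=> [xE mom [Bu _ _] [_ ce] _].
have [c2 e2 _ _] := mom j.
apply: cov_mx_mulmx => //.
apply: filterS (xE j) => t {}xE.
rewrite -[LHS](mulKmx Bu); congr (_ *m _).
by apply/eqP; rewrite mulmxBl mul1mx subr_eq addrC addrA; exact/eqP.
Qed.

Lemma Sigma_e_const (R : realType) (p : nat) (J : finType) (B : 'M[R]_p)
    (M : environments R p J) (i j : J) : shift_model B M ->
  Sigma_e M i = Sigma_e M j.
Proof.
move=> [_ mom _ [law _] _].
have [_ i2 i0 _] := mom i; have [_ j2 j0 _] := mom j.
exact: same_law_cov_mx.
Qed.

(** Since all environments share [Sigma_e], its average over the others equals its value at [j] and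
    drops out of the difference. *)
Lemma DeltaSigma_x (R : realType) (p : nat) (J : finType) (B : 'M[R]_p)
    (M : environments R p J) (j : J) : (2 <= #|J|)%N -> shift_model B M ->
  DeltaSigma (Sigma_x M) j =
  invmx (1%:M - B) *m DeltaSigma (Sigma_c M) j *m (invmx (1%:M - B))^T.
Proof.
move=> J2 BM; rewrite /DeltaSigma /Sigma_minus.
set A := invmx _; set n : R := _%:R.
(* [n] is [#|J| - 1]. Were it 0, its inverse would be 0 by convention and the noise term would not
   cancel. *)
have n0 : n != 0 by rewrite pnatr_eq0 -lt0n -ltnS prednK// ltnW.
have sumE : \sum_(j' | j' != j) Sigma_x M j' =
    A *m (\sum_(j' | j' != j) Sigma_c M j' + n *: Sigma_e M j) *m A^T.
  have -> : n *: Sigma_e M j = \sum_(j' | j' != j) Sigma_e M j'.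
    rewrite (eq_bigr (fun=> Sigma_e M j)) => [|i _].
      by rewrite sumr_const scaler_nat cardC1.
    exact: (Sigma_e_const _ _ BM).
  rewrite -big_split mulmx_sumr mulmx_suml.
  by apply: eq_bigr => i _; exact: Sigma_xE.
rewrite (Sigma_xE _ BM) sumE -/A scalemxAl scalemxAr -mulmxBl -mulmxBr.
congr (_ *m _ *m _).
by rewrite scalerDr scalerA mulVf// scale1r opprD addrACA subrr addr0.
Qed.

(** * Non-uniqueness for two environments *)

Section Open.
Context {R : realType} {p : nat} {T : Type} (F : set_system T) {FF : Filter F}.

Lemma cvg_prod (I : Type) (r : seq I) (f : I -> T -> R) (l : I -> R) :
  (forall i, f i t @[t --> F] --> l i) ->
  \prod_(i <- r) f i t @[t --> F] --> \prod_(i <- r) l i.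
Proof. by move=> fl; apply: cvg_big => //; exact: mul_continuous. Qed.

Lemma cvg_det (D : T -> 'M[R]_p) (D0 : 'M[R]_p) :
  (forall i j, D t i j @[t --> F] --> D0 i j) ->
  \det (D t) @[t --> F] --> \det D0.
Proof.
move=> DD0; apply: cvg_big => //; first exact: add_continuous.
by move=> s _; apply: cvgMr; exact: cvg_prod.
Qed.

(** [CP] is a maximum over finitely many cycles, so the bound is a finite conjunction of strict
    inequalities on products that are continuous in the entries. *)
Lemma near_CP_lt1 (D : T -> 'M[R]_p) (D0 : 'M[R]_p) :
  (forall i j, D t i j @[t --> F] --> D0 i j) ->
  CP D0 < 1 -> \forall t \near F, CP (D t) < 1.
Proof.
move=> DD0 /bigmax_ltP[_ H].
suff : \forall t \near F, forall (eta : 'I_p.+1) (m : eta.+1.-tuple 'I_p),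
    (1 < eta)%N -> is_cycle m ->
    \prod_(k < eta)
      `| D t (tnth m (lift ord0 k)) (tnth m (widen_ord (leqnSn eta) k)) | < 1.
  apply: filterS => t Ht; apply/bigmax_ltP; split=> // eta eta1.
  by apply/bigmax_ltP; split=> // m mc; exact: Ht.
apply: filter_forall => eta; apply: filter_forall => m.
case: (boolP (1 < eta)%N) => [eta1|_]; last exact: nearW.
case: (boolP (is_cycle m)) => [mc|_]; last exact: nearW.
have /bigmax_ltP[_ /(_ m mc) lt1] := H eta eta1.
have cv := @cvg_prod _ (index_enum 'I_eta) (fun k t =>
    `|D t (tnth m (lift ord0 k)) (tnth m (widen_ord (leqnSn eta) k))|) _
   (fun k => cvg_norm (DD0 _ _)).
apply: filterS (cvgr_lt _ (cv FF) _ lt1) => t tlt1 _ _; exact: tlt1.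
Qed.

(** Invertibility and [CP < 1] are open conditions; the unit diagonal is not, hence it is required
    separately. *)
Lemma near_Dcp (D : T -> 'M[R]_p) (D0 : 'M[R]_p) :
  (forall i j, D t i j @[t --> F] --> D0 i j) -> Dcp D0 ->
  (\forall t \near F, forall k, D t k k = 1) -> \forall t \near F, Dcp (D t).
Proof.
move=> DD0 [D0u _ D0cp] D1.
have hu : \forall t \near F, D t \in unitmx.
  have {}D0u : \det D0 != 0 by rewrite -unitfE -unitmxE.
  apply: filterS (cvgr_neq0 _ (cvg_det DD0) D0u) => t.
  by rewrite unitmxE unitfE.
have hcp : \forall t \near F, CP (1%:M - D t) < 1.
  apply: near_CP_lt1 D0cp => i j.
  have -> : (1%:M - D0) i j = (1%:M : 'M[R]_p) i j - D0 i j by rewrite !mxE.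
  have -> : (fun t => (1%:M - D t) i j) = (fun t => (1%:M : 'M[R]_p) i j - D t i j).
    by apply/funext => t; rewrite !mxE.
  by apply: cvgB => //; exact: cvg_cst.
by apply: filterS3 hu D1 hcp => t ? ? ?; split.
Qed.

End Open.

(* W is a small perturbation of the identity in the plane of two coordinates
   k, l: for N = al E_kl + be E_lk with al h_l + be h_k = 0, the terms of
   (1 + t N) diag(h) (1 + t N)^T linear in t cancel and those in t^2 are
   diagonal. The factors r restore the unit diagonal of W C. *)
Lemma Dcp_diag_not_unique (R : realType) (p : nat) (C : 'M[R]_p) (h : 'rV[R]_p) :
  (2 <= p)%N -> Dcp C ->
  exists W : 'M[R]_p, [/\ Dcp (W *m C), W != 1%:M &
     is_diag_mx (W *m diag_mx h *m W^T)].
Proof.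
move=> p2 CD; have [_ C1 _] := CD.
pose k : 'I_p := Ordinal (ltnW p2); pose l : 'I_p := Ordinal p2.
have kl : k != l by [].
(* The pair [(h_k, -h_l)] solves the equation and is nonzero unless both entries vanish; then any
   pair does, such as [(1, 0)]. *)
have [al [be [ab abh]]] : exists al be : R, (al != 0) || (be != 0) /\
    al * h 0 l + be * h 0 k = 0.
  have [hk0|hk] := eqVneq (h 0 k) 0; last first.
    by exists (h 0 k), (- h 0 l); rewrite hk; split=> //; ring.
  have [hl0|hl] := eqVneq (h 0 l) 0; last first.
    by exists (h 0 k), (- h 0 l); rewrite oppr_eq0 hl orbT; split=> //; ring.
  by exists 1, 0; rewrite oner_neq0 hl0; split=> //; ring.
pose N : 'M[R]_p := al *: delta_mx k l + be *: delta_mx l k.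
have ex x : (x == k) && (x == l) = false.
  by apply/andP => -[/eqP->]; rewrite (negbTE kl).
have dis i j y : i != j -> (i == y) && (j == y) = false.
  by move=> ij; apply/andP => -[/eqP iy /eqP jy]; rewrite iy jy eqxx in ij.
(* Only rows [k] and [l] of [N] can be nonzero, with supports in the distinct columns [l] and [k];
   hence [N diag(h) N^T] is diagonal. *)
have Nort i j m : i != j -> N i m * N j m = 0.
  move=> ij; rewrite !mxE.
  move: (ex m) (dis _ _ _ k ij) (dis _ _ _ l ij).
  case: (i == k); case: (i == l); case: (j == k); case: (j == l);
    case: (m == k); case: (m == l) => //= _ _ _;
    by rewrite ?(mulr0, mul0r, add0r, addr0).
have Nh i j : N i j * h 0 j = al * h 0 l * ((i == k) && (j == l))%:R +
    be * h 0 k * ((i == l) && (j == k))%:R.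
  rewrite !mxE mulrDl !(mulrAC _ (_%:R)); congr (_ + _).
    by have [->|_] := eqVneq j l; rewrite ?andbF ?mulr0.
  by have [->|_] := eqVneq j k; rewrite ?andbF ?mulr0.
(* The coefficient of [t] in [(1 + t N) diag(h) (1 + t N)^T] is [N diag(h)] plus its transpose. *)
have Nsym i j : N i j * h 0 j + N j i * h 0 i = 0.
  rewrite !Nh (andbC (j == k)) (andbC (j == l)).
  transitivity ((al * h 0 l + be * h 0 k) *
    (((i == k) && (j == l))%:R + ((i == l) && (j == k))%:R)); first by ring.
  by rewrite abh mul0r.
have sum_delta i (f : 'I_p -> R) : \sum_m (i == m)%:R * f m = f i.
  rewrite (bigD1 i)//= eqxx mul1r big1 ?addr0 => [//|m /negbTE im].
  by rewrite eq_sym im mul0r.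
(* Since [C] has unit diagonal, [r t i] is the inverse of the [i]-th diagonal entry of
   [(1 + t N) C]; [W t] is [1 + t N] with rows scaled by [r t]. *)
pose r t i : R := (1 + t * (N *m C) i i)^-1.
pose W t : 'M[R]_p := \matrix_(i, j) (r t i * (i == j)%:R + t * r t i * N i j).
have WCE t i j : (W t *m C) i j = r t i * (C i j + t * (N *m C) i j).
  rewrite mxE (eq_bigr (fun m => r t i * ((i == m)%:R * C m j)
    + t * r t i * (N i m * C m j))) => [|m _]; last by rewrite mxE; ring.
  rewrite big_split /= -!mulr_sumr [(N *m C) i j]mxE.
  rewrite (bigD1 i)//= eqxx mul1r big1 ?addr0 => [|m /negbTE im].
    by ring.
  by rewrite eq_sym im mul0r.
have Wdiag t : is_diag_mx (W t *m diag_mx h *m (W t)^T).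
  apply/is_diag_mxP => i j ij; rewrite mxE.
  have {}ij : i != j by [].
  rewrite (eq_bigr (fun m => r t i * r t j * t *
      ((i == m)%:R * (N j m * h 0 m) + (j == m)%:R * (N i m * h 0 m)))) => [|m _].
    by rewrite -mulr_sumr big_split /= !sum_delta Nsym mulr0.
  have d0 : (i == m)%:R * (j == m)%:R = 0 :> R by rewrite -natrM mulnb dis.
  (* Expansion by degree in [t]: off the diagonal the constant term vanishes by [d0] and the
     quadratic one by [Nort]; the linear one is left to [Nsym]. *)
  transitivity (r t i * r t j * t *
      ((i == m)%:R * (N j m * h 0 m) + (j == m)%:R * (N i m * h 0 m)) +
    r t i * r t j * h 0 m * ((i == m)%:R * (j == m)%:R) +
    r t i * r t j * t ^+ 2 * h 0 m * (N i m * N j m)); last first.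
    by rewrite d0 (Nort _ _ _ ij) !mulr0 !addr0.
  by rewrite mul_mx_diag mxE [_^T m j]mxE /W mxE [in X in _ * X]mxE; ring.
(* Punctured neighbourhoods keep [t] nonzero, so that [W t] differs from the identity. *)
pose F := (0 : R)^'.
have rcvg i : 1 + t * (N *m C) i i @[t --> F] --> (1 : R).
  suff : 1 + t * (N *m C) i i @[t --> F] --> 1 + 0 * (N *m C) i i.
    by rewrite mul0r addr0.
  apply: cvgD; first exact: cvg_cst.
  apply: cvgM; last exact: cvg_cst.
  exact: nbhs_dnbhs.
have r0 i : \forall t \near F, 1 + t * (N *m C) i i != 0.
  by apply: cvgr_neq0 (rcvg i) _; exact: oner_neq0.
have {}r0 : \forall t \near F, forall i, 1 + t * (N *m C) i i != 0.
  exact: filter_forall.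
have WD : \forall t \near F, Dcp (W t *m C).
  apply: (near_Dcp _ CD) => [i j|]; last first.
    by apply: filterS r0 => t r0 i; rewrite WCE C1 mulVf.
  under eq_fun do rewrite WCE.
  suff : r t i * (C i j + t * (N *m C) i j) @[t --> F] -->
      1^-1 * (C i j + 0 * (N *m C) i j) by rewrite invr1 mul1r mul0r addr0.
  apply: cvgM; first exact: cvgV (oner_neq0 _) (rcvg i).
  apply: cvgD; first exact: cvg_cst.
  apply: cvgM; last exact: cvg_cst.
  exact: nbhs_dnbhs.
have t0 : \forall t \near F, t != 0 :> R by exact: nbhs_dnbhs_neq.
have [t [WtD {}t0 {}r0]] : exists t, [/\ Dcp (W t *m C), t != 0 &
    forall i, 1 + t * (N *m C) i i != 0].
  apply: (@filter_ex _ F).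
  by apply: filterS3 WD t0 r0 => t ? ? ?; split.
exists (W t); split=> //.
(* The [(k, l)] and [(l, k)] entries of [W t] are nonzero multiples of [al] and [be], which are not
   both 0. *)
apply/eqP => /matrixP W1.
have rt0 i : r t i != 0 by rewrite invr_neq0.
have := W1 k l; have := W1 l k.
rewrite !mxE !eqxx (eq_sym l k) (negbTE kl) /= ?(mulr0, mulr1, add0r, addr0) => /eqP.
rewrite !mulf_eq0 (negbTE t0) (negbTE (rt0 _)) /= => /eqP be0 /eqP.
rewrite !mulf_eq0 (negbTE t0) (negbTE (rt0 _)) /= => /eqP al0.
by move: ab; rewrite al0 be0 eqxx.
Qed.

Section Loss.
Context {R : realType} {p : nat}.
Implicit Types A : 'M[R]_p.

Lemma loss_ge0 A : 0 <= loss A.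
Proof. by do 2!apply: sumr_ge0 => ? _; exact: sqr_ge0. Qed.

Lemma diag_loss A : is_diag_mx A -> loss A = 0.
Proof.
move=> /is_diag_mxP A0; rewrite /loss big1// => k _; rewrite big1// => l lk.
by rewrite A0 ?expr0n// eq_sym.
Qed.

End Loss.

(** * The model with two environments *)

Section TwoEnvironments.
Context {R : realType} {p : nat} {J : finType}.
Context (J2 : #|J| = 2%N).

Lemma DeltaSigma_card2 (S : J -> 'M[R]_p) (i j : J) : i != j ->
  DeltaSigma S i = S i - S j.
Proof.
move=> ij; rewrite /DeltaSigma /Sigma_minus J2 invr1 scale1r.
rewrite (big_pred1 j)// => k; apply/idP/eqP => [ki|->]; last by rewrite eq_sym.
have : k \in [set i; j]%SET.
  suff -> : [set i; j]%SET = finset.setT by rewrite inE.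
  by apply/eqP; rewrite eqEcard finset.subsetT cardsT cards2 ij J2.
by rewrite !inE (negbTE ki) => /eqP.
Qed.

Lemma eta_card2 (M : environments R p J) (i j : J) (k : 'I_p) : i != j ->
  eta M i k = - eta M j k.
Proof.
move=> ij; rewrite /eta (DeltaSigma_card2 _ ij).
by rewrite (@DeltaSigma_card2 _ j i) 1?eq_sym// -[in LHS]opprB mxE.
Qed.

(** The vectors [eta] of the two environments are opposite, hence proportional. *)
Lemma not_condition_U_card2 (M : environments R p J) : (2 <= p)%N ->
  ~ condition_U M.
Proof.
move=> p2 U.
have [|i [j]] := U (Ordinal (ltnW p2)) (Ordinal p2); first by [].
have [->|ij] := eqVneq i j; first by rewrite mulrC eqxx.
by rewrite !(eta_card2 _ _ ij) !mulNr mulrC eqxx.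
Qed.

(** Both [1 - B] and [W (1 - B)] lie in [Dcp] and give the nonnegative objective the value 0, so
    both minimize it. *)
Lemma not_identifiable_card2 (M : environments R p J) (B : 'M[R]_p) :
  (2 <= p)%N -> shift_model B M -> ~ identifiable M.
Proof.
move=> p2 BM [D0 [_ D0_unique]].
have [_ _ [Cu CPB B0] _ Sdiag] := BM.
pose C : 'M[R]_p := 1%:M - B.
(* [C] undoes the mixing in [DeltaSigma (Sigma_x M) j], leaving [W] to act on the diagonal
   intervention terms. *)
have objE W : objective M (W *m C) =
    \sum_j loss (W *m DeltaSigma (Sigma_c M) j *m W^T).
  apply: eq_bigr => j _; rewrite (DeltaSigma_x _ _ BM) ?J2//.
  by rewrite trmx_mul !mulmxA mulmxK// -(mulmxA _ (invmx _)^T) -trmx_mul mulmxV//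
    trmx1 mulmx1.
have CD : Dcp C.
  by split=> // [k|]; rewrite /C ?subKr// !mxE eqxx B0 subr0.
have [i _] : exists i : J, i \in J by apply/card_gt0P; rewrite J2.
have /diag_mxP[h hE] : is_diag_mx (DeltaSigma (Sigma_c M) i).
  apply/is_diag_mxP => k l kl.
  have S0 j : Sigma_c M j k l = 0 by have /is_diag_mxP := Sdiag j; apply.
  rewrite /DeltaSigma /Sigma_minus; move: (Sigma_c M) S0 => S S0.
  by rewrite !mxE summxE S0 big1 ?mulr0 ?subr0.
have [W [WD W1 Wh]] := Dcp_diag_not_unique h p2 CD.
have obj0 V : is_diag_mx (V *m diag_mx h *m V^T) -> objective M (V *m C) = 0.
  move=> Vh; rewrite objE big1// => j _; apply: diag_loss.
  have [->|ji] := eqVneq j i; first by rewrite hE.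
  (* The other environment carries [- diag_mx h], so a single [W] keeps both matrices diagonal. *)
  rewrite (_ : DeltaSigma _ j = - diag_mx h).
    rewrite mulmxN mulNmx; apply/is_diag_mxP => k l kl.
    by rewrite mxE (is_diag_mxP Vh)// oppr0.
  rewrite -hE (DeltaSigma_card2 _ ji) (@DeltaSigma_card2 _ i j) 1?eq_sym//.
  by rewrite opprB.
have min0 D : Dcp D -> objective M D = 0 -> is_minimizer (objective M) Dcp D.
  move=> DD D_0; split=> // D' _.
  by rewrite D_0; apply: sumr_ge0 => j _; exact: loss_ge0.
have D0C : D0 = C.
  apply/D0_unique/min0 => //; rewrite -[C]mul1mx; apply: obj0.
  by rewrite mul1mx trmx1 mulmx1 diag_mx_is_diag.
have D0W : D0 = W *m C by apply/D0_unique/min0 => //; exact: obj0.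
(* Uniqueness gives [W C = C], and invertibility of [C] forces [W = 1]. *)
by move/eqP: W1; apply; rewrite -[W](mulmxK Cu) -/C -D0W D0C mulmxV.
Qed.

End TwoEnvironments.

(** The random choice of variances in (ii) lives on a space [Omega] of its own: each outcome [w]
    gives a whole model [M w], whose intervention variances are the values [V j k w]. *)
Theorem corollary2 (R : realType) (p : nat) (J : finType) (B : 'M[R]_p)
    (hp : (2 <= p)%N) (hJ : (2 <= #|J|)%N) :
  (forall M : environments R p J, shift_model B M ->
     ((#|J| = 2)%N ->
        (forall (k : 'I_p) (j j' : J), j != j' -> eta M j k = - eta M j' k) /\
        ~ condition_U M) /\
     (identifiable M -> (3 <= #|J|)%N)) /\
  (forall (d : measure_display) (Omega : measurableType d)
     (P : probability Omega R) (M : Omega -> environments R p J)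
     (V : J -> 'I_p -> {RV P >-> R})
     (mu : probability (measurableTypeR R) R),
     (3 <= #|J|)%N ->
     (forall w, shift_model B (M w)) ->
     (forall w j k, V j k w = Sigma_c (M w) j k k) ->
     mutually_independent P (fun i : J * 'I_p => V i.1 i.2 : Omega -> R) ->
     (forall j k, same_law (distribution P (V j k)) mu) ->
     mu `<< (@lebesgue_measure R) ->
     {ae P, forall w, condition_U (M w)}).
Proof.
split=> [M BM|d Omega P M V mu J3 _ VE Vind Vlaw mu_ac].
  split=> [J2|Mid].
    split; last exact: not_condition_U_card2.
    by move=> k j j' jj'; exact: eta_card2.
  rewrite ltn_neqAle hJ andbT eq_sym; apply/eqP => J2.
  exact: not_identifiable_card2 BM Mid.
exact: independent_condition_U J3 VE Vind Vlaw mu_ac.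
Qed.
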